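(* Let $\lambda\in\mathbb{R}$ and $r\in\mathbb{N}\cup\{0\}$. For all $n,k\in\mathbb{N}\cup\{0\}$ with $n\ge k$, $$S_{2,r}(n+r,k+r|\lambda)=\sum_{l=k}^{n}\sum_{m=0}^{n-l}\binom{n}{l}\,r^m\,\lambda^{n-m-l}\,S_1(n-l,m)\,S_{2,\lambda}(l,k).$$
   Context: All generating functions are formal power series in $t$. For a number $y$, $(1+\lambda t)^{y/\lambda}$ denotes the formal power series $\sum_{n\ge0}(y|\lambda)_n\frac{t^n}{n!}$, where $(y|\lambda)_0=1$ and $(y|\lambda)_n=y(y-\lambda)(y-2\lambda)\cdots(y-(n-1)\lambda)$ for $n\ge1$ (for $\lambda=0$ this is the limit $e^{yt}$). The convention $0^0=1$ is used. The (signed) Stirling numbers of the first kind $S_1(n,k)$ are defined by $(x)_n=\sum_{k=0}^n S_1(n,k)x^k$, where $(x)_0=1$ and $(x)_n=x(x-1)\cdots(x-n+1)$ for $n\ge1$. The degenerate Stirling numbers of the second kind $S_{2,\lambda}(n,k)$ are defined, for $k\ge0$, by $$\frac{1}{k!}\left((1+\lambda t)^{1/\lambda}-1\right)^k=\sum_{n=k}^\infty S_{2,\lambda}(n,k)\frac{t^n}{n!}.$$ The extended degenerate Stirling numbers of the second kind $S_{2,r}(n+r,k+r|\lambda)$ are defined, for $r,k\in\mathbb{N}\cup\{0\}$, by $$\frac{1}{k!}(1+\lambda t)^{r/\lambda}\left((1+\lambda t)^{1/\lambda}-1\right)^k=\sum_{n=k}^\infty S_{2,r}(n+r,k+r|\lambda)\frac{t^n}{n!}.$$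 *)

(* Defs.v *)
From mathcomp Require Import all_boot all_order all_algebra.
From mathcomp Require Import reals.
Set Implicit Arguments.
Unset Strict Implicit.
Unset Printing Implicit Defensive.
Import Order.TTheory GRing.Theory Num.Theory.
Local Open Scope ring_scope.

(* The formal power series \sum_n (a n) t^n.  Functions nat -> R may also carry
   a pointwise ring structure; the operations below are the power series
   ones. *)
Definition fps (R : realType) := nat -> R.

Definition fps_one (R : realType) : fps R := fun n => (n == 0%N)%:R.

Definition fps_sub (R : realType) (a b : fps R) : fps R := fun n => a n - b n.

Definition fps_scale (R : realType) (c : R) (a : fps R) : fps R :=
  fun n => c * a n.

Definition fps_mul (R : realType) (a b : fps R) : fps R :=
  fun n => \sum_(i < n.+1) a i * b (n - i)%N.

Definition fps_pow (R : realType) (a : fps R) (k : nat) : fps R :=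
  iter k (fps_mul a) (fps_one R).

(* (y | lambda)_n *)
Definition deg_falling (R : realType) (lam y : R) (n : nat) : R :=
  \prod_(i < n) (y - i%:R * lam).

(* (1 + lambda t)^(y / lambda); for lambda = 0 this is e^(y t), since
   (y | 0)_n = y ^+ n. *)
Definition deg_exp (R : realType) (lam y : R) : fps R :=
  fun n => deg_falling lam y n / (n`!)%:R.

(* Signed: the coefficient of x^k in x (x - 1) ... (x - n + 1). *)
Definition stirling1 (n k : nat) : int :=
  (\prod_(i < n) ('X - (i%:R)%:P) : {poly int})`_k.

(* n! times the coefficient of t^n in
   (1 / k!) ((1 + lambda t)^(1 / lambda) - 1)^k. *)
Definition deg_stirling2 (R : realType) (lam : R) (n k : nat) : R :=
  (n`!)%:R *
  fps_scale (k`!)%:R^-1 (fps_pow (fps_sub (deg_exp lam 1) (fps_one R)) k) n.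

(* S_{2,r}(N, K | lambda), meaningful for r <= N and r <= K: with N = n + r and
   K = k + r it is n! times the coefficient of t^n in
   (1 / k!) (1 + lambda t)^(r / lambda) ((1 + lambda t)^(1 / lambda) - 1)^k. *)
Definition ext_deg_stirling2 (R : realType) (lam : R) (r N K : nat) : R :=
  let n := (N - r)%N in
  let k := (K - r)%N in
  (n`!)%:R *
  fps_scale (k`!)%:R^-1
    (fps_mul (deg_exp lam r%:R)
       (fps_pow (fps_sub (deg_exp lam 1) (fps_one R)) k)) n.

(* The generating functions defining the two families of numbers start at
   t^k. *)
Lemma fps_pow_deg_exp_eq0 (R : realType) (lam : R) (n k : nat) :
  (n < k)%N -> fps_pow (fps_sub (deg_exp lam 1) (fps_one R)) k n = 0.
Proof.
elim: k n => [|k IHk] n //; rewrite ltnS => le_nk.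
rewrite /fps_pow iterS -/(fps_pow _ k) {1}/fps_mul big1 // => -[[|i] /= lt_i] _.
  by rewrite /fps_sub /deg_exp /deg_falling /fps_one big_ord0 divr1 subrr mul0r.
rewrite IHk ?mulr0 //; apply: leq_trans le_nk.
rewrite ltn_subrL /=; exact: leq_ltn_trans (leq0n i) lt_i.
Qed.

Lemma deg_stirling2_eq0 (R : realType) (lam : R) (n k : nat) :
  (n < k)%N -> deg_stirling2 lam n k = 0.
Proof.
by move=> lt_nk; rewrite /deg_stirling2 /fps_scale fps_pow_deg_exp_eq0 ?mulr0.
Qed.

Lemma ext_deg_stirling2_eq0 (R : realType) (lam : R) (r n k : nat) :
  (n < k)%N -> ext_deg_stirling2 lam r (n + r) (k + r) = 0.
Proof.
move=> lt_nk; rewrite /ext_deg_stirling2 !addnK /fps_scale /fps_mul big1.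
  by rewrite !mulr0.
move=> i _; rewrite fps_pow_deg_exp_eq0 ?mulr0 //.
exact: leq_ltn_trans (leq_subr _ _) lt_nk.
Qed.

(* Main.v *)
Require Import Defs.
From mathcomp Require Import all_boot all_order all_algebra.
From mathcomp Require Import reals.
From mathcomp Require Import ring.
Import Order.TTheory GRing.Theory Num.Theory.
Local Open Scope ring_scope.

(** Multiplying by (1 + lambda t)^(r / lambda) is a binomial convolution of the
    numbers [deg_stirling2 lam l k] with (r | lambda)_(n-l), and (y | lambda)_n
    is the homogenization, in y and lambda, of the falling factorial
    polynomial whose coefficients are the Stirling numbers S_1(n, m). *)

Lemma stirling1_gt (n m : nat) : (n < m)%N -> stirling1 n m = 0.
Proof.
move=> lt_nm; rewrite /stirling1 nth_default //.
by rewrite size_prod_XsubC /index_enum -enumT size_enum_ord.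
Qed.

(** Compare coefficients in (x)_{n+1} = (x)_n (x - n), where multiplication by x contributes nothing
    to the constant term. *)
Lemma stirling1S0 (n : nat) : stirling1 n.+1 0 = - (stirling1 n 0 * n%:R).
Proof.
by rewrite /stirling1 big_ord_recr /= mulrBr coefB coefMX coefMC sub0r.
Qed.

Lemma stirling1SS (n m : nat) :
  stirling1 n.+1 m.+1 = stirling1 n m - stirling1 n m.+1 * n%:R.
Proof. by rewrite /stirling1 big_ord_recr /= mulrBr coefB coefMX coefMC. Qed.

(** Induction on n through the last factor y - n lam. Only natural powers of [lam] occur, so
    [lam = 0] needs no separate case. *)
Lemma deg_falling_stirling1 (R : realType) (lam y : R) (n : nat) :
  deg_falling lam y n =
  \sum_(m < n.+1) y ^+ m * lam ^+ (n - m) * (stirling1 n m)%:~R.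
Proof.
elim: n => [|n IHn].
  by rewrite /deg_falling /stirling1 big_ord0 big_ord1 big_ord0 coef1 !mul1r.
rewrite /deg_falling big_ord_recr /= -/(deg_falling lam y n) mulrBr {2}IHn.
have -> : (\sum_(m < n.+1) y ^+ m * lam ^+ (n - m) * (stirling1 n m)%:~R)
    * (n%:R * lam) =
  \sum_(m < n.+2) y ^+ m * lam ^+ (n.+1 - m) * (stirling1 n m * n%:R)%:~R.
  (* The added top term m = n+1 vanishes, as S_1(n, n+1) = 0. *)
  rewrite [RHS]big_ord_recr /= stirling1_gt // mul0r mulr0 addr0 mulr_suml.
  apply: eq_bigr => m _; rewrite subSn ?leq_ord // exprS rmorphM /= rmorph_nat; ring.
(* The m = 0 term comes from the n lam part alone; elsewhere index m of the y part meets index m+1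
   of the other. *)
rewrite IHn [in X in _ - X]big_ord_recl [RHS]big_ord_recl /= stirling1S0.
rewrite opprD addrCA rmorphN mulrN; congr (_ + _).
rewrite mulr_suml -sumrB; apply: eq_bigr => m _.
by rewrite /bump /= add1n subSS stirling1SS exprS rmorphB /=; ring.
Qed.

Theorem theorem2p1 (R : realType) (lam : R) (r n k : nat) (hkn : (k <= n)%N) :
  ext_deg_stirling2 lam r (n + r) (k + r) =
  \sum_(k <= l < n.+1) \sum_(0 <= m < (n - l).+1)
    'C(n, l)%:R * r%:R ^+ m * lam ^+ (n - m - l)
    * (stirling1 (n - l) m)%:~R * deg_stirling2 lam l k.
Proof.
transitivity (\sum_(k <= l < n.+1)
  'C(n, l)%:R * deg_falling lam r%:R (n - l) * deg_stirling2 lam l k); last first.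
  apply: eq_bigr => l _; rewrite deg_falling_stirling1 big_mkord.
  rewrite mulr_sumr mulr_suml; apply: eq_bigr => m _.
  by rewrite subnAC !mulrA.
transitivity (\sum_(0 <= l < n.+1)
  'C(n, l)%:R * deg_falling lam r%:R (n - l) * deg_stirling2 lam l k); last first.
  (* The terms with l < k are zero, so the sum may start at 0 like a Cauchy product. *)
  rewrite (@big_cat_nat _ _ _ k) ?leqW //= big_nat big1 ?add0r // => l /andP[_ lk].
  by rewrite deg_stirling2_eq0 ?mulr0.
rewrite /ext_deg_stirling2 !addnK /deg_stirling2 /fps_scale /fps_mul.
(* The Cauchy product is indexed by i = n - l, the degree taken from [deg_exp]. *)
rewrite big_mkord [RHS](reindex_inj rev_ord_inj) /= !mulr_sumr.
apply: eq_bigr => i _; have le_in : (i <= n)%N by exact: leq_ord.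
(* Writing n! as C(n,i) i! (n-i)!, the i! cancels the denominator in [deg_exp] and (n-i)! is the
   normalization of [deg_stirling2]. *)
rewrite subSS subKn // bin_sub // /deg_exp -(bin_fact le_in) !natrM.
have fi0 : i`!%:R != 0 :> R by rewrite pnatr_eq0 -lt0n fact_gt0.
have fk0 : k`!%:R != 0 :> R by rewrite pnatr_eq0 -lt0n fact_gt0.
by field; rewrite fi0 fk0.
Qed.
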